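(* Let $A\subset \mathbb{R}$ be a finite set with $|A|\ge 2$ and let $\delta_2 = 2/5$. Then there are two disjoint subsets $B$ and $C$ of $A$ such that $A = B\sqcup C$ and $$\max\{ D^{+} (B), D^{\times} (C)\} \lesssim |A|^{1-\delta_2}.$$ Besides, this inequality cannot hold with $\delta_2$ replaced by any number greater than $3/4$; that is, for every $\delta>3/4$ and all constants $K,c>0$ there is a finite set $A\subset\mathbb{R}$ such that for every partition $A=B\sqcup C$ one has $\max\{ D^{+} (B), D^{\times} (C)\} > K|A|^{1-\delta}(\log|A|)^c$.
   Context: For a nonempty finite set $X\subset\mathbb{R}$, $D^{+}(X)$ is the infimum of all $D>0$ such that for every finite set $G\subset\mathbb{R}$ and every real $\tau\ge 1$, $$|\{ s\in X-G : |X\cap (G+s)|\ge\tau\}| \le \frac{D\,|X|\,|G|^2}{\tau^3}.$$ Similarly $D^{\times}(X)$ is the infimum of all $D>0$ such that for every finite set $G\subset\mathbb{R}$ and every real $\tau\ge1$, $$|\{ s\in X/G : |X\cap sG|\ge\tau\}| \le \frac{D\,|X|\,|G|^2}{\tau^3},$$ where $X/G=\{x/g: x\in X, g\in G, g\neq 0\}$ and $sG=\{sg:g\in G\}$. (For the empty set these quantities may be taken to be $0$.) The notation $a\lesssim b$ means $a\le K\, b\,(\log|A|)^c$ for some absolute constants $K,c>0$. *)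

(* Defs.v *)
From mathcomp Require Import all_boot all_order all_algebra finmap.
From mathcomp Require Import classical_sets reals exp.
Set Implicit Arguments.
Unset Strict Implicit.
Unset Printing Implicit Defensive.

Import Order.TTheory GRing.Theory Num.Theory.
Local Open Scope fset_scope.
Local Open Scope ring_scope.

Definition diff_fset (R : realType) (X G : {fset R}) : {fset R} :=
  [fset x - g | x in X, g in G].

Definition translate_fset (R : realType) (G : {fset R}) (s : R) : {fset R} :=
  [fset g + s | g in G].

Definition quot_fset (R : realType) (X G : {fset R}) : {fset R} :=
  [fset x / g | x in X, g in G `\ 0].

Definition dilate_fset (R : realType) (s : R) (G : {fset R}) : {fset R} :=
  [fset s * g | g in G].

Definition Dplus_bound (R : realType) (X : {fset R}) (D : R) : Prop :=
  forall (G : {fset R}) (tau : R), 1 <= tau ->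
    #|` [fset s in diff_fset X G
          | tau <= #|` X `&` translate_fset G s|%:R] |%:R
      <= D * #|` X|%:R * #|` G|%:R ^+ 2 / tau ^+ 3.

Definition Dtimes_bound (R : realType) (X : {fset R}) (D : R) : Prop :=
  forall (G : {fset R}) (tau : R), 1 <= tau ->
    #|` [fset s in quot_fset X G
          | tau <= #|` X `&` dilate_fset s G|%:R] |%:R
      <= D * #|` X|%:R * #|` G|%:R ^+ 2 / tau ^+ 3.

(* Both infima are over nonempty sets of positive reals (for X nonempty,
   D = 2 #|` X| is admissible), so [inf] never takes its default value.
   For X empty every D > 0 is admissible and both quantities are 0. *)
Definition Dplus (R : realType) (X : {fset R}) : R :=
  inf [set D : R | 0 < D /\ Dplus_bound X D]%classic.

Definition Dtimes (R : realType) (X : {fset R}) : R :=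
  inf [set D : R | 0 < D /\ Dtimes_bound X D]%classic.

(* Main.v *)
(** Solutions of h + sig = s g with h in H, g in G, sig in Sig, s in S are
    incidences between the points of H x G and the lines indexed by (sig, s).
    Cutting H x G by quantiles into a grid gives the Szemeredi-Trotter bound
    O((|H||G||Sig||S|)^(2/3)); it has no lower order terms because the point set
    is a Cartesian product.

    If D^x(C) > D, as witnessed by G and a set S of dilations, then the elements
    of C have many representations s g. By pigeonholing over superlevel sets
    (at the cost of a factor log|C|) some nonempty X in C has at least q
    representations per element, with q|X| large; the incidence bound then
    makes the sum over sig of |X cap (H + sig)| small. Remove such sets X from C
    until D^x of the rest is at most D. The estimates for the removed sets add
    up, and by concavity of t^(2/3) their union B satisfies
    D^+(B) <<  (log|A|)^3 |A| / D. Take D of order |A|^(3/5).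

    For the converse let A = {(P + i) 2^j : i < P, j < Q} with P = Q^2. Either
    half of some row lies in B, and since rows are arithmetic progressions
    D^+(B) >> P/Q = Q; or C contains half of every row, hence at least a
    quarter of each of P/4 columns, and since columns are geometric
    progressions D^x(C) >> Q. As |A| <= Q^3, the maximum is >> |A|^(1/3). *)
Require Import Defs.
From mathcomp Require Import all_boot all_order all_algebra finmap.
From mathcomp Require Import classical_sets reals exp.
From mathcomp Require Import boolp zify ring lra.
Set Implicit Arguments.
Unset Strict Implicit.
Unset Printing Implicit Defensive.
Import Order.TTheory GRing.Theory Num.Theory.
Local Open Scope fset_scope.
Local Open Scope ring_scope.

(** * Incidences between Cartesian products and lines *)

Lemma sum_le1_of_unique (T : eqType) (s : seq T) (P : pred T) : uniq s ->
  {in s &, forall x y, P x -> P y -> x = y} ->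
  (\sum_(x <- s) P x <= 1)%N.
Proof.
elim: s => [|a s IHs] /=; first by rewrite big_nil.
case/andP=> a_s uniq_s Puniq; rewrite big_cons.
have {}IHs : (\sum_(x <- s) P x <= 1)%N.
  apply: IHs => // x y xs ys; apply: Puniq; rewrite inE ?xs ?ys orbT //.
case Pa: (P a) => //=.
rewrite big_seq big1 ?addn0 // => x xs.
case Px: (P x) => //=.
have xa : x = a by apply: Puniq; rewrite ?inE ?eqxx ?xs ?orbT.
by rewrite xa (negPf a_s) in xs.
Qed.

Lemma sum_nat_bool (T : eqType) (s : seq T) (P : pred T) :
  (\sum_(x <- s) P x)%N = size [seq x <- s | P x].
Proof.
by rewrite size_filter -sum1_count [RHS]big_mkcond; apply: eq_bigr => x _; case: (P x).
Qed.

(* Each class of k points on a line satisfies k <= 1 + k(k-1), and the pairs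
   counted by k(k-1) are close pairs, each lying on at most one line. *)
Lemma incidence_le_classes (T U : eqType) (P : seq T) (L : seq U)
    (inc : T -> U -> bool) (cls : U -> T -> nat) (close : rel T) (V M : nat) :
  uniq P ->
  (forall l p, p \in P -> l \in L -> inc p l -> (cls l p < V)%N) ->
  {in P &, forall p p', p != p' ->
     (\sum_(l <- L) (inc p l && inc p' l) <= 1)%N} ->
  (forall l p p', p \in P -> p' \in P -> l \in L -> inc p l -> inc p' l ->
     cls l p = cls l p' -> close p p') ->
  {in P, forall p, (\sum_(p' <- P) close p p' <= M)%N} ->
  (\sum_(l <- L) \sum_(p <- P) inc p l <= size L * V + size P * M)%N.
Proof.
move=> uniqP clsV inc1 cls_close closeM.
pose k l v := (\sum_(p <- P) (inc p l && (cls l p == v)))%N.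
pose I := (\sum_(l <- L) \sum_(p <- P) inc p l)%N.
have kk l (v : 'I_V) : (k l v * k l v = \sum_(p <- P) \sum_(p' <- P)
    (inc p l && (cls l p == v)) * (inc p' l && (cls l p' == v)))%N.
  by rewrite /k big_distrlr.
have Ik : I = (\sum_(l <- L) \sum_(v < V) k l v)%N.
  rewrite /I big_seq [RHS]big_seq; apply: eq_bigr => l lL.
  rewrite exchange_big /= big_seq [RHS]big_seq; apply: eq_bigr => p pP.
  case incpl: (inc p l) => /=; last by rewrite big1.
  rewrite (bigD1 (Ordinal (clsV l p pP lL incpl))) //= eqxx big1 // => i.
  by rewrite -val_eqE /= eq_sym => /negPf ->.
have Ik2 : (\sum_(l <- L) \sum_(v < V) k l v * k l v <= I + size P * M)%N.
  have -> : (\sum_(l <- L) \sum_(v < V) k l v * k l v)%N =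
     (\sum_(l <- L) \sum_(p <- P) \sum_(p' <- P)
        (inc p l && inc p' l && (cls l p == cls l p')))%N.
    rewrite big_seq [RHS]big_seq; apply: eq_bigr => l lL.
    rewrite (eq_bigr _ (fun v _ => kk l v)).
    rewrite exchange_big /= big_seq [RHS]big_seq; apply: eq_bigr => p pP.
    rewrite exchange_big /=; apply: eq_bigr => p' _.
    case incpl: (inc p l) => /=; last by rewrite big1.
    rewrite (bigD1 (Ordinal (clsV l p pP lL incpl))) //= eqxx mul1n big1.
      by rewrite addn0 [_ == cls l p]eq_sym.
    by move=> i; rewrite -val_eqE /= eq_sym => /negPf ->.
  have : (\sum_(l <- L) \sum_(p <- P) \sum_(p' <- P)
        (inc p l && inc p' l && (cls l p == cls l p')) <=
     \sum_(l <- L) \sum_(p <- P) (inc p l +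
       \sum_(p' <- P) ((p != p') && close p p') * (inc p l && inc p' l)))%N.
    rewrite big_seq [leqRHS]big_seq; apply: leq_sum => l lL.
    rewrite big_seq [leqRHS]big_seq; apply: leq_sum => p pP.
    rewrite (bigD1_seq p) //= !eqxx andbb andbT leq_add2l big_mkcond /=.
    rewrite big_seq [leqRHS]big_seq; apply: leq_sum => p' p'P.
    rewrite eq_sym; case: eqP => //= _.
    case: (boolP (inc p l)) => //= ipl; case: (boolP (inc p' l)) => //= ip'l.
    by case: eqP => // e; rewrite (cls_close l p p').
  move=> /leq_trans; apply.
  under eq_bigr => l _ do rewrite big_split /=.
  rewrite big_split leq_add2l exchange_big /=.
  apply: (@leq_trans (\sum_(p <- P) M)%N); last first.
    by rewrite big_const_seq count_predT iter_addn_0 mulnC.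
  rewrite big_seq [leqRHS]big_seq; apply: leq_sum => p pP.
  apply: leq_trans (closeM p pP); rewrite exchange_big /=.
  rewrite big_seq [leqRHS]big_seq; apply: leq_sum => p' p'P.
  rewrite -big_distrr /=; case: (eqVneq p p') => //= npp'.
  case: (close p p'); rewrite // mul1n; exact: inc1.
(* Sum [2 k <= k ^ 2 + 1] over the [V] classes of every line; one copy of [I] then cancels against
   the diagonal pairs in [Ik2]. *)
have : (I + I <= \sum_(l <- L) \sum_(v < V) k l v * k l v + size L * V)%N.
  rewrite {1 2}Ik -big_split /=.
  have -> : (size L * V = \sum_(l <- L) \sum_(v < V) 1)%N.
    by rewrite sum1_card card_ord big_const_seq count_predT iter_addn_0 mulnC.
  rewrite -big_split; apply: leq_sum => l _.
  by rewrite -!big_split; apply: leq_sum => v _ /=; nia.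
rewrite -/I; lia.
Qed.

(** Quantile blocks: [f x] is the number of elements of [G] below [x], divided by [m]. Ranks are
    distinct on [G], so at most [m] elements share a block. *)
Lemma monotone_blocks (disp : Order.disp_t) (T : orderType disp) (G : seq T)
    (m : nat) : uniq G -> (0 < m)%N ->
  exists f : T -> nat,
    [/\ {homo f : x y / (x <= y)%O >-> (x <= y)%N},
        {in G, forall x, (f x * m < size G)%N} &
        forall x, (\sum_(y <- G) (f x == f y) <= m)%N].
Proof.
move=> uniqG m_gt0; pose rank x := count (fun y => (y < x)%O) G.
have rank_lt x y : x \in G -> (x < y)%O -> (rank x < rank y)%N.
  move=> xG xy; rewrite /rank -!sum1_count [ltnRHS]big_mkcond (bigD1_seq x) //= xy.
  rewrite add1n ltnS big_mkcond [leqRHS]big_mkcond; apply: leq_sum => z _.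
  case: ifP => // zx; rewrite (lt_trans zx xy).
  by move: zx; case: eqP => // ->; rewrite ltxx.
have rank_inj : {in G &, injective rank}.
  move=> x y xG yG e; case: (ltgtP x y) => // xy.
    by have := rank_lt _ _ xG xy; rewrite e ltnn.
  by have := rank_lt _ _ yG xy; rewrite e ltnn.
exists (fun x => rank x %/ m)%N; split.
- move=> x y xy; apply: leq_div2r; apply: sub_count => z zx.
  exact: lt_le_trans zx xy.
- move=> x xG; apply: leq_ltn_trans (leq_divM _ _) _.
  rewrite /rank ltn_neqAle count_size andbT; apply: contraL xG.
  by rewrite -all_count => /allP h; apply/negP => /h; rewrite ltxx.
- move=> x; rewrite sum_nat_bool.
  set F := [seq _ <- _ | _]; rewrite -(size_map rank).
  rewrite -[leqRHS](size_iota (rank x %/ m * m)); apply: uniq_leq_size.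
    rewrite map_inj_in_uniq ?filter_uniq // => y z.
    by rewrite !mem_filter => /andP[_ yG] /andP[_ zG]; apply: rank_inj.
  move=> k /mapP[y]; rewrite mem_filter => /andP[/eqP e yG] ->.
  by rewrite mem_iota e leq_divM /= addnC -mulSn ltn_ceil.
Qed.

Definition incidences (R : realType) (H G Sig S : seq R) : nat :=
  (\sum_(l <- [seq (sig, s) | sig <- Sig, s <- S])
    \sum_(p <- [seq (h, g) | h <- H, g <- G]) (p.1 + l.1 == l.2 * p.2)%R)%N.

(* The points of H x G are distributed over an r x r grid of cells by quantiles.
   On a line of positive slope both cell coordinates increase, so the sum of
   the two coordinates determines the cell; on a line of negative slope their
   difference does. *)
Lemma incidences_le_grid (R : realType) (H G Sig S : seq R) (r : nat) :
  uniq H -> uniq G -> uniq Sig -> uniq S -> 0 \notin S -> (0 < r)%N ->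
  (incidences H G Sig S <= size Sig * size S * (2 * r) +
     size H * size G * ((size H %/ r).+1 * (size G %/ r).+1))%N.
Proof.
move=> uH uG uSig uS S0 r_gt0.
have [f [f_homo f_lt f_fib]] := monotone_blocks uH (ltn0Sn (size H %/ r)).
have [g [g_homo g_lt g_fib]] := monotone_blocks uG (ltn0Sn (size G %/ r)).
(* Blocks of size [(n %/ r).+1] exceed [n / r], so only indices below [r] occur. *)
have blk (n i : nat) : (i * (n %/ r).+1 < n -> i < r)%N.
  move=> h; have := ltn_ceil n r_gt0 => h2.
  have : (i * (n %/ r).+1 < r * (n %/ r).+1)%N by rewrite [ltnRHS]mulnC; lia.
  by rewrite ltn_mul2r.
rewrite -(size_allpairs pair Sig S) -(size_allpairs pair H G).
(* Reflecting [f] by [r.-1] keeps the difference a natural number; in both cases the value is below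
   [2 * r]. *)
pose cls (l p : R * R) := (g p.2 + (if (0 < l.2)%R then f p.1 else r.-1 - f p.1))%N.
apply: (@incidence_le_classes _ _ _ _ (fun p l => p.1 + l.1 == l.2 * p.2) cls
   (fun p p' => (f p.1 == f p'.1) && (g p.2 == g p'.2))).
- by apply: allpairs_uniq => // -[? ?] [? ?].
- move=> [sig s] [h k] /allpairsP[[? ?] /= [hH kG [-> ->]]] _ _ /=.
  have := blk _ _ (f_lt _ hH); have := blk _ _ (g_lt _ kG).
  by rewrite /cls /=; case: ifP => _; lia.
- move=> [h k] [h' k'] _ _ /= npp'; apply: sum_le1_of_unique.
    by apply: allpairs_uniq => // -[? ?] [? ?].
  move=> [sig s] [sig' s'] _ _ /= /andP[/eqP e1 /eqP e2] /andP[/eqP e3 /eqP e4].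
  have kk : k - k' != 0.
    apply: contraNneq npp' => /eqP; rewrite subr_eq0 => /eqP kk.
    rewrite kk in e1; have -> : h = h' by apply: (addIr sig); rewrite e1 e2.
    by rewrite kk.
  have es : s = s'.
    by apply: (mulIf kk); rewrite !mulrBr -e1 -e2 -e3 -e4; ring.
  by rewrite es; congr pair; apply: (addrI h); rewrite e1 e3 es.
- move=> [sig s] p p' pP p'P.
  move=> /allpairsP[[sig' s'] /= [_ sS [_ /= es']]]; rewrite -{}es' in sS => {sig' s'}.
  wlog le_pp' : p p' pP p'P / p.2 <= p'.2.
    move=> W; case: (leP p.2 p'.2) => [|/ltW] h i1 i2 e; first exact: W.
    by rewrite eq_sym [g _ == _]eq_sym; apply: W.
  move: pP p'P le_pp' => /allpairsP[[h k] /= [hH kG ->]].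
  move=> /allpairsP[[h' k'] /= [h'H k'G ->]] /= kk' /eqP i1 /eqP i2.
  have := blk _ _ (f_lt _ hH); have := blk _ _ (f_lt _ h'H).
  have := g_homo _ _ kk'; rewrite /cls /=; case: ltP => s0.
    have hh' : (f h <= f h')%N by apply: f_homo; rewrite -(lerD2r sig) i1 i2 ler_pM2l.
    by move: hh'; lia.
  have s_lt0 : s < 0.
    by rewrite lt_neqAle s0 andbT; apply: contraNneq S0 => <-.
  have hh' : (f h' <= f h)%N by apply: f_homo; rewrite -(lerD2r sig) i1 i2 ler_nM2l.
  by move: hh'; lia.
- move=> [h k] /= _; rewrite big_allpairs /=.
  under eq_bigr => h' _.
    under eq_bigr => k' _ do rewrite -mulnb.
    rewrite -big_distrr /=; over.
  by rewrite -big_distrl leq_mul.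
Qed.

Lemma leq_sum_size (T : eqType) (s : seq T) (F : T -> nat) (M : nat) :
  {in s, forall x, (F x <= M)%N} -> (\sum_(x <- s) F x <= size s * M)%N.
Proof.
move=> FM; rewrite mulnC -iter_addn_0 -count_predT -big_const_seq big_seq [leqRHS]big_seq.
exact: leq_sum.
Qed.

Lemma size_leq_sum (T : eqType) (s : seq T) (F : T -> nat) (M : nat) :
  {in s, forall x, (M <= F x)%N} -> (size s * M <= \sum_(x <- s) F x)%N.
Proof.
move=> MF; rewrite mulnC -iter_addn_0 -count_predT -big_const_seq.
by rewrite [leqLHS]big_seq [leqRHS]big_seq; apply: leq_sum.
Qed.

(** In [h + sig = s * g] any three variables determine the fourth. Solving for [g] uses [s != 0],
    and solving for [s] uses [g != 0]. *)
Lemma incidences_le_trivial (R : realType) (H G Sig S : seq R) :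
  uniq H -> uniq G -> uniq Sig -> uniq S -> 0 \notin G -> 0 \notin S ->
  let I := incidences H G Sig S in
  [/\ (I <= size Sig * size S * size G)%N,
      (I <= size Sig * size S * size H)%N,
      (I <= size H * size G * size S)%N &
      (I <= size H * size G * size Sig)%N].
Proof.
move=> uH uG uSig uS G0 S0 /=.
have swap : incidences H G Sig S =
    (\sum_(p <- [seq (h, g) | h <- H, g <- G])
      \sum_(l <- [seq (sig, s) | sig <- Sig, s <- S]) (p.1 + l.1 == l.2 * p.2)%R)%N.
  by rewrite [RHS]exchange_big.
split.
- rewrite -(size_allpairs pair Sig S); apply: leq_sum_size => -[sig s] _ /=.
  rewrite big_allpairs exchange_big /= -[leqRHS]muln1; apply: leq_sum_size => g _ /=.
  apply: sum_le1_of_unique => // h h' _ _ /eqP e /eqP e'.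
  by apply: (addIr sig); rewrite e e'.
- rewrite -(size_allpairs pair Sig S); apply: leq_sum_size => -[sig s].
  case/allpairsP=> -[? s'] /= [_ s'S [_ ->]].
  rewrite big_allpairs /= -[leqRHS]muln1; apply: leq_sum_size => h _ /=.
  apply: sum_le1_of_unique => // g g' _ _ /eqP e /eqP e'.
  by apply: (mulfI (memPn S0 _ s'S)); rewrite -e e'.
- rewrite swap -(size_allpairs pair H G); apply: leq_sum_size => -[h g] _ /=.
  rewrite big_allpairs exchange_big /= -[leqRHS]muln1; apply: leq_sum_size => s _ /=.
  apply: sum_le1_of_unique => // sig sig' _ _ /eqP e /eqP e'.
  by apply: (addrI h); rewrite e e'.
- rewrite swap -(size_allpairs pair H G); apply: leq_sum_size => -[h g].
  case/allpairsP=> -[? g'] /= [_ g'G [_ ->]].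
  rewrite big_allpairs /= -[leqRHS]muln1; apply: leq_sum_size => sig _ /=.
  apply: sum_le1_of_unique => // s s' _ _ /eqP e /eqP e'.
  by apply: (mulIf (memPn G0 _ g'G)); rewrite -e e'.
Qed.

(** With [N] points and [L] lines the grid bound reads, up to constants, [L r + N ^ 2 / r ^ 2],
    balanced at [r ^ 3] of order [N ^ 2 / L]. The trivial bounds cover the cases where this [r] is
    below 1 or exceeds a side of the grid. Cubing keeps everything in the natural numbers. *)
Lemma incidences_cube_le (R : realType) (H G Sig S : seq R) :
  uniq H -> uniq G -> uniq Sig -> uniq S -> 0 \notin G -> 0 \notin S ->
  (incidences H G Sig S ^ 3 <=
     24 ^ 3 * (size H * size G * (size Sig * size S)) ^ 2)%N.
Proof.
move=> uH uG uSig uS G0 S0.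
have [IG IH IS ISig] := incidences_le_trivial uH uG uSig uS G0 S0.
have grid := incidences_le_grid uH uG uSig uS S0.
(* 24 ^ 3 is hidden because conversion would unfold it in unary. *)
have [c cE c_gt0] : exists2 c, c = (8 ^ 2 * 6 ^ 3)%N & (0 < c)%N.
  by exists (8 ^ 2 * 6 ^ 3)%N; rewrite ?muln_gt0 ?expn_gt0.
rewrite -[24%N]/(4 * 6)%N expnMn -[(4 ^ 3)%N]/(8 ^ 2)%N -cE.
have e1 (a x y z : nat) : (a * (x ^ 3 * y) * (a * (x ^ 3 * y)) * z ^ 3 =
    a ^ 2 * (y ^ 2 * (x ^ 2 * z) ^ 3))%N by lia.
have e2 (a b x y : nat) : (x ^ 4 * (a ^ 2 * b ^ 3 * (x * y) ^ 2) =
    a ^ 2 * (y ^ 2 * (b * x ^ 2) ^ 3))%N by lia.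
move: (incidences _ _ _ _) IG IH IS ISig grid => I.
move: (size H) (size G) (size Sig) (size S) => h g sig s IG IH IS ISig grid.
set N := (h * g)%N in IS ISig grid *; set L := (sig * s)%N in IG IH grid *.
have [N0|N_gt0] := posnP N; first by move: IS; rewrite N0; case: (I).
have [L0|L_gt0] := posnP L; first by move: IG; rewrite L0; case: (I).
(* Here no [r >= 1] is available. Multiplying two trivial bounds gives
   [I ^ 2 <= N ^ 2 * L <= L ^ 2], which suffices. *)
have [NL|LN] := ltnP (N ^ 2) L.
  have I2 : (I ^ 2 <= N ^ 2 * L)%N.
    by rewrite /L expnS expn1; apply: leq_trans (leq_mul ISig IS) _; lia.
  have IL : (I <= L)%N.
    rewrite -leq_sqr; apply: leq_trans I2 _.
    by rewrite (expnS L) expn1 leq_mul2r ltnW ?orbT.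
  rewrite expnS; apply: leq_trans (leq_mul IL I2) _.
  by rewrite (expnMn N) (expnS L 1) expn1 mulnC -mulnA leq_pmull.
have exr : exists r, (r ^ 3 * L <= N ^ 2)%N by exists 1%N; rewrite exp1n mul1n.
have bndr r : (r ^ 3 * L <= N ^ 2)%N -> (r <= N ^ 2)%N.
  move=> /(leq_trans _); apply; apply: (leq_trans (leq_pmulr r L_gt0)).
  by rewrite leq_mul2r; case: r => [|r]; rewrite ?orbT // expnS leq_pmulr ?orbT ?expn_gt0.
have [r r_spec r_max] := ex_maxnP exr bndr.
have r_gt0 : (0 < r)%N by apply: r_max; rewrite exp1n mul1n.
(* If [r] exceeds a side [x], then [I <= L * x <= L * r], and [L ^ 3 * r ^ 3 <= N ^ 2 * L ^ 2] by
   the choice of [r]. *)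
have small x : (I <= L * x)%N -> (x < r)%N ->
    (I ^ 3 <= c * (N * L) ^ 2)%N.
  move=> Ix xr.
  have : (I ^ 3 <= (L * r) ^ 3)%N.
    by rewrite leq_exp2r //; apply: leq_trans Ix _; rewrite leq_mul2l ltnW ?orbT.
  move=> /leq_trans; apply; rewrite (expnMn L) (expnMn N).
  have : (L ^ 3 * r ^ 3 <= N ^ 2 * L ^ 2)%N.
    by rewrite (expnS L) mulnAC [(_ * r ^ 3)%N]mulnC leq_mul2r r_spec orbT.
  by move=> /leq_trans; apply; rewrite leq_pmull.
have [gr|rg] := ltnP g r; first exact: small IG gr.
have [hr|rh] := ltnP h r; first exact: small IH hr.
have side x : (r <= x)%N -> ((x %/ r).+1 * r <= 2 * x)%N.
  by move=> rx; rewrite mulSn; have := leq_divM x r; lia.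
have r2I : (r ^ 2 * I <= 6 * N ^ 2)%N.
  have cells : (r ^ 2 * ((h %/ r).+1 * (g %/ r).+1) <= 4 * N)%N.
    have -> : (4 * N = 2 * h * (2 * g))%N by rewrite /N; lia.
    apply: leq_trans (leq_mul (side h rh) (side g rg)).
    by rewrite [leqRHS]mulnACA mulnC.
  have := leq_mul (leqnn (r ^ 2)) (grid r r_gt0).
  move=> /leq_trans; apply; rewrite mulnDr.
  have -> : (6 * N ^ 2 = 2 * N ^ 2 + N * (4 * N))%N by rewrite expnS expn1; lia.
  apply: leq_add; last by rewrite mulnCA leq_mul2l cells orbT.
  by move: r_spec; rewrite (expnS r 2); lia.
(* By maximality of [r], and [r.+1 <= 2 * r]. *)
have N2r : (N ^ 2 <= 8 * (r ^ 3 * L))%N.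
  have : ~~ (r.+1 ^ 3 * L <= N ^ 2)%N by apply/negP => /r_max; rewrite ltnn.
  rewrite -ltnNge => /ltnW /leq_trans; apply.
  rewrite mulnA leq_mul2r; apply/orP; right.
  by rewrite -[8%N]/(2 ^ 3)%N -expnMn leq_exp2r //; lia.
(* Squaring [N2r] gives [N ^ 4 <= 8 ^ 2 * r ^ 6 * L ^ 2], and cubing [r2I] gives
   [r ^ 6 * I ^ 3 <= 6 ^ 3 * N ^ 6]; hence the constant [8 ^ 2 * 6 ^ 3 = 24 ^ 3]. *)
have : (N ^ 4 * I ^ 3 <= N ^ 4 * (c * (N * L) ^ 2))%N.
  have -> : (N ^ 4 * I ^ 3 = (N ^ 2) ^ 2 * I ^ 3)%N by rewrite -expnM.
  have := leq_mul (leq_mul N2r N2r) (leqnn (I ^ 3)).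
  move=> /leq_trans; apply.
  rewrite e1 cE e2 leq_mul2l; apply/orP; right.
  by rewrite leq_mul2l leq_exp2r // r2I orbT.
by rewrite leq_pmul2l // expn_gt0 N_gt0.
Qed.

(** * Pigeonholing over superlevel sets *)

Definition harm (R : realType) (n : nat) : R := \sum_(k < n) k.+1%:R^-1.

Lemma seq_argmax (R : realType) (T : eqType) (s : seq T) (f : T -> R) :
  s != [::] -> exists2 a, a \in s & {in s, forall b, f b <= f a}.
Proof.
elim: s => // a s IHs _; have [->|/IHs[b bs b_max]] := eqVneq s [::].
  by exists a; rewrite ?mem_head // => b; rewrite inE => /eqP ->.
have [ab|/ltW ba] := leP (f a) (f b).
  exists b; first by rewrite inE bs orbT.
  by move=> c; rewrite inE => /predU1P[->|/b_max].
exists a; first exact: mem_head.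
move=> c; rewrite inE => /predU1P[->//|/b_max cb]; exact: le_trans cb ba.
Qed.

(** A minimiser of [r] has all of [s] in its superlevel set, so its value is at most [M / size s].
    Removing minimisers one by one sums these bounds to a harmonic number. *)
Lemma sum_le_harm (R : realType) (T : eqType) (s : seq T) (r : T -> nat) (M : nat) :
  {in s, forall a, (r a * count (fun b => r a <= r b)%N s <= M)%N} ->
  (\sum_(a <- s) r a)%:R <= M%:R * harm R (size s).
Proof.
move: {2}(size s) (erefl (size s)) => n; elim: n s => [|n IHn] s.
  by move=> /size0nil -> _; rewrite big_nil /harm big_ord0 mulr0.
move=> size_s rM; have s_n0 : s != [::] by rewrite -size_eq0 size_s.
have [a a_s a_min] := seq_argmax (fun x => - (r x)%:R : R) s_n0.
have perm_s := perm_to_rem a_s.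
have size_rem : size (rem a s) = n by rewrite size_rem // size_s.
rewrite (perm_big _ perm_s) big_cons size_s /harm big_ord_recr /= natrD mulrDr addrC.
apply: lerD.
  move: (IHn _ size_rem); rewrite size_rem; apply => // b bs; have {}bs := mem_rem bs.
  apply: leq_trans (rM b bs); rewrite leq_mul2l; apply/orP; right.
  by rewrite (permP perm_s) /= leq_addl.
rewrite ler_pdivlMr ?ltr0Sn // -natrM ler_nat -size_s.
have := rM a a_s; congr (_ * _ <= _)%N; apply/eqP; rewrite -all_count.
by apply/allP => b /a_min; rewrite lerN2 ler_nat.
Qed.

(** The level maximising value times size supplies the [M] of [sum_le_harm]; the loss is only
    logarithmic. *)
Lemma exists_rich_level (R : realType) (T : eqType) (s : seq T) (r : T -> nat) :
  s != [::] -> exists2 a, a \in s &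
  (\sum_(a <- s) r a)%:R <=
    (r a * count (fun b => r a <= r b)%N s)%:R * harm R (size s).
Proof.
move=> s_n0.
have [a a_s a_max] :=
  seq_argmax (fun a => (r a * count (fun b => r a <= r b)%N s)%:R : R) s_n0.
by exists a => //; apply: sum_le_harm => b /a_max; rewrite ler_nat.
Qed.

Lemma size_ler_sum (R : realType) (T : eqType) (s : seq T) (F : T -> R) (m : R) :
  {in s, forall x, m <= F x} -> m * (size s)%:R <= \sum_(x <- s) F x.
Proof.
move=> mF; rewrite mulr_natr -iter_addr_0 -count_predT -big_const_seq.
rewrite big_seq [leRHS]big_seq; exact: ler_sum.
Qed.

(** * Cube roots and the functional [spread] *)

Definition cbrt (R : realType) (x : R) : R := x `^ 3^-1.

Lemma cbrt_ge0 (R : realType) (x : R) : 0 <= cbrt x.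
Proof. exact: powR_ge0. Qed.

Lemma cbrtK (R : realType) (x : R) : 0 <= x -> cbrt x ^+ 3 = x.
Proof.
by move=> x0; rewrite -powR_mulrn ?powR_ge0 // -powRrM mulVf ?powRr1 ?pnatr_eq0.
Qed.

Lemma cbrt_gt0 (R : realType) (x : R) : 0 < x -> 0 < cbrt x.
Proof. exact: powR_gt0. Qed.

Lemma le_cbrt (R : realType) (x y : R) : 0 <= x -> x <= y -> cbrt x <= cbrt y.
Proof.
by move=> x0 xy; apply: ge0_ler_powR; rewrite ?nnegrE ?invr_ge0 ?ler0n // (le_trans x0).
Qed.

Lemma cbrtM (R : realType) (x y : R) :
  0 <= x -> 0 <= y -> cbrt (x * y) = cbrt x * cbrt y.
Proof. exact: powRM. Qed.

Lemma ler_cube (R : realType) (x y : R) : 0 <= y -> x ^+ 3 <= y ^+ 3 -> x <= y.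
Proof.
move=> y0 h; have [//|yx] := leP x y.
by move: h; rewrite ler_pXn2r ?nnegrE // ?(le_trans y0 (ltW yx)) // leNgt yx.
Qed.

Definition shift_count (R : realType) (X G S : seq R) : nat :=
  (\sum_(s <- S) \sum_(x <- X) ((x - s)%R \in G))%N.

(* Unlike the level set estimate [Dplus_bound], this form is subadditive in X
   (see [spreadU]): it replaces a weak L^3 quasinorm by an equivalent norm. *)
Definition spread (R : realType) (X : {fset R}) (alpha : R) : Prop :=
  forall G S : seq R, uniq G -> uniq S ->
    (shift_count X G S)%:R <= alpha * cbrt ((size G * size S)%:R ^+ 2).

Lemma spreadU (R : realType) (X Y : {fset R}) (a b : R) :
  [disjoint X & Y] -> spread X a -> spread Y b -> spread (X `|` Y) (a + b).
Proof.
move=> XY Xa Yb G S uG uS; rewrite mulrDl.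
apply: le_trans (lerD (Xa G S uG uS) (Yb G S uG uS)).
rewrite -natrD ler_nat /shift_count -big_split /=; apply: leq_sum => s _.
rewrite -big_cat /= (perm_big (X ++ Y)) //; apply: uniq_perm => //.
  rewrite cat_uniq !fset_uniq andbT /=; apply/hasPn => x xY.
  by apply/negP => xX; move/fdisjointP: XY => /(_ x xX); rewrite xY.
by move=> x; rewrite mem_cat in_fsetU.
Qed.

Lemma card_translate (R : realType) (X G : {fset R}) (s : R) :
  #|` X `&` translate_fset G s| = (\sum_(x <- X) ((x - s)%R \in G))%N.
Proof.
rewrite sum_nat_bool; apply: perm_size; apply: uniq_perm => //.
  by rewrite filter_uniq.
move=> x; rewrite mem_filter in_fsetI andbC; congr (_ && _).
apply/imfsetP/idP => [[g /= gG ->]|xG]; first by rewrite addrK.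
by exists (x - s) => //=; rewrite subrK.
Qed.

(** Testing [spread] on [G] and the level set [S] gives [tau |S| <= alpha (|G| |S|)^(2/3)]; cube and
    cancel [|S| ^ 2]. *)
Lemma spread_Dplus_bound (R : realType) (X : {fset R}) (alpha D : R) :
  0 <= alpha -> spread X alpha -> alpha ^+ 3 <= D * #|` X|%:R -> Dplus_bound X D.
Proof.
move=> alpha0 Xalpha alphaD G tau tau1.
have tau0 : 0 < tau by apply: lt_le_trans tau1.
have tau3 : 0 < tau ^+ 3 by rewrite exprn_gt0.
set S := [fset s in _ | _].
have tauS s : s \in S -> tau <= (\sum_(x <- X) ((x - s)%R \in G))%:R.
  by rewrite !inE -card_translate => /andP[].
have [S0|S_gt0] := posnP #|` S|.
  have DX : 0 <= D * #|` X|%:R by apply: le_trans alphaD; rewrite exprn_ge0.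
  by rewrite S0 divr_ge0 ?(ltW tau3) // mulr_ge0 // exprn_ge0.
have sum_ge : tau * #|` S|%:R <= (shift_count X G S)%:R.
  rewrite /shift_count natr_sum; apply: size_ler_sum => s; exact: tauS.
have := le_trans sum_ge (Xalpha G S (fset_uniq _) (fset_uniq _)).
move=> /(lerXn2r 3) /=; rewrite !nnegrE !mulr_ge0 ?cbrt_ge0 ?ler0n ?(ltW tau0) //.
move=> /(_ isT isT); rewrite !exprMn cbrtK ?exprn_ge0 ?ler0n // natrM exprMn.
move=> le3.
have S2 : 0 < #|` S|%:R ^+ 2 :> R by rewrite exprn_gt0 ?ltr0n.
rewrite ler_pdivlMr //; apply: (@le_trans _ _ (alpha ^+ 3 * #|` G|%:R ^+ 2)).
  by rewrite -(ler_pM2r S2); move: le3; rewrite -mulrA; congr (_ <= _); ring.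
by rewrite ler_wpM2r // exprn_ge0.
Qed.

(** * A spread subset wherever [Dtimes_bound] fails *)

Lemma card_quot_fset (R : realType) (X G : {fset R}) :
  (#|` quot_fset X G| <= #|` X| * #|` G|)%N.
Proof.
rewrite -(size_allpairs (fun x g => x / g) X G); apply: uniq_leq_size => // y.
case/imfset2P=> x /= xX [g /=]; rewrite !inE => /andP[_ gG] ->.
by apply/allpairsP; exists (x, g).
Qed.

(** Dropping 0 from [G], as the incidence bound requires, loses only the element [x = 0]. *)
Lemma card_dilate_le (R : realType) (X G : {fset R}) (s : R) : s != 0 ->
  (#|` X `&` dilate_fset s G| <= (\sum_(x <- X) ((x / s)%R \in G `\ 0%R)).+1)%N.
Proof.
move=> s0.
have -> : #|` X `&` dilate_fset s G| = (\sum_(x <- X) ((x / s)%R \in G))%N.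
  rewrite sum_nat_bool; apply: perm_size; apply: uniq_perm => //.
    by rewrite filter_uniq.
  move=> x; rewrite mem_filter in_fsetI andbC; congr (_ && _).
  apply/imfsetP/idP => [[g /= gG ->]|xG]; first by rewrite mulrAC divff ?mul1r.
  by exists (x / s) => //=; rewrite mulrCA divff ?mulr1.
have /leq_trans-> // : (\sum_(x <- X) ((x / s)%R \in G) <=
    \sum_(x <- X) (((x / s)%R \in G `\ 0%R) + (x == 0%R)))%N.
  apply: leq_sum => x _; rewrite !inE mulf_eq0 invr_eq0 (negPf s0) orbF.
  by case: eqP => //=; case: (_ \in _).
rewrite big_split /= -addn1 leq_add2l; apply: sum_le1_of_unique; first exact: fset_uniq.
by move=> x y _ _ /eqP -> /eqP ->.
Qed.

(** Every counted pair [x = h + sig] combines with the at least [q] representations [x = s * g] into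
    incidences. For fixed [sig] and [s], the point [(x - sig, x / s)] recovers [x]. *)
Lemma shift_count_le_incidences (R : realType) (X H G Sig S : seq R) (q : nat) :
  uniq X -> 0 \notin S ->
  {in X, forall x, (q <= \sum_(s <- S) ((x / s)%R \in G))%N} ->
  (q * shift_count X H Sig <= incidences H G Sig S)%N.
Proof.
move=> uX S0 qX; rewrite /incidences big_allpairs /= big_distrr /=.
apply: leq_sum => sig _.
apply: (@leq_trans (\sum_(x <- X) \sum_(s <- S)
    (((x - sig)%R \in H) && ((x / s)%R \in G)))%N).
  rewrite big_distrr big_seq [leqRHS]big_seq; apply: leq_sum => x xX /=.
  by case: (_ \in H); rewrite ?muln0 // muln1; apply: qX.
rewrite exchange_big big_seq [leqRHS]big_seq /=; apply: leq_sum => s sS.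
have s0 : s != 0 := memPn S0 _ sS.
rewrite !sum_nat_bool /=; set F := [seq x <- X | _].
rewrite -(size_map (fun x => (x - sig, x / s))); apply: uniq_leq_size.
  rewrite map_inj_uniq ?filter_uniq // => x y [/addIr]; exact.
move=> p /mapP[x]; rewrite !mem_filter => /andP[/andP[xH xG] _] -> /=.
rewrite subrK mulrCA divff // mulr1 eqxx /=.
by apply/allpairsP; exists (x - sig, x / s).
Qed.

Lemma exists_spread_subset (R : realType) (C : {fset R}) (D : R) :
  8 <= D -> ~ Dtimes_bound C D ->
  exists X : {fset R}, [/\ X `<=` C, X != fset0 &
    spread X (48 * harm R #|` C| * #|` X|%:R / cbrt (D * #|` C|%:R))].
Proof.
move=> D8 /existsNP[G /existsNP[tau /not_implyP[tau1 /negP]]].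
set S := [fset s in _ | _]; rewrite -ltNge => S_large.
have tau0 : 0 < tau by apply: lt_le_trans tau1.
have tau3 : 0 < tau ^+ 3 by rewrite exprn_gt0.
have S_quot : S `<=` quot_fset C G by apply/fsubsetP=> s; rewrite !inE => /andP[].
have S_le : (#|` S| <= #|` C| * #|` G|)%N.
  exact: leq_trans (fsubset_leq_card S_quot) (card_quot_fset _ _).
have D0 : 0 < D by apply: lt_le_trans D8.
have S_gt0 : (0 < #|` S|)%N.
  rewrite -(ltr_nat R); apply: le_lt_trans S_large.
  by rewrite divr_ge0 ?(ltW tau3) // !mulr_ge0 ?exprn_ge0 // ltW.
have /andP[C_gt0 G_gt0] : (0 < #|` C|)%N && (0 < #|` G|)%N.
  by rewrite -muln_gt0; apply: leq_trans S_le.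
(* For [tau <= 2] the trivial bound [|S| <= |C| |G|] would already be at most [8 |C| |G|^2 / tau^3];
   this is the role of [8 <= D]. *)
have tau2 : 2 < tau.
  rewrite ltNge; apply/negP => tau_le2; move: S_large; apply/negP; rewrite -leNgt.
  rewrite ler_pdivlMr //; apply: (@le_trans _ _ (#|` S|%:R * 8)).
    rewrite ler_wpM2l // (_ : 8 = 2 ^+ 3); last by rewrite -natrX.
    by rewrite lerXn2r ?nnegrE // ltW.
  rewrite mulrC -mulrA; apply: ler_pM => //.
  by rewrite -natrX -natrM ler_nat; nia.
have S_tau s : s \in S -> tau <= #|` C `&` dilate_fset s G|%:R.
  by rewrite !inE => /andP[].
(* The dilate by 0 has at most one element, fewer than [tau]. *)
have S0 : 0 \notin S.
  apply/negP => /S_tau; apply/negP; rewrite -ltNge; apply: le_lt_trans tau2.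
  rewrite ler_nat; apply: (@leq_trans #|` [fset 0 : R]|); last by rewrite cardfs1.
  apply: fsubset_leq_card; apply/fsubsetP => x; rewrite !inE => /andP[_].
  by case/imfsetP => g _ ->; rewrite mul0r.
pose r x := (\sum_(s <- S) ((x / s)%R \in G `\ 0%R))%N.
(* The element lost in [card_dilate_le] is affordable since [tau - 1 >= tau / 2]. *)
have sum_r : tau / 2 * #|` S|%:R <= (\sum_(x <- C) r x)%:R.
  rewrite /r exchange_big natr_sum; apply: size_ler_sum => s sS.
  have := S_tau s sS; have := card_dilate_le C G (memPn S0 _ sS).
  rewrite -(ler_nat R) -natr1 /=; lra.
have [|x xC] := exists_rich_level R r (s := C); first by rewrite -size_eq0 -lt0n.
set q := r x; set n := count _ _; move=> qn_large.
pose X := [fset y in C | (q <= r y)%N].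
have XC : X `<=` C by apply/fsubsetP=> y; rewrite !inE => /andP[].
have card_X : #|` X| = n.
  rewrite /n -size_filter; apply: perm_size; apply: uniq_perm => //.
    by rewrite filter_uniq.
  by move=> y; rewrite mem_filter !inE andbC.
exists X; split=> //; first by apply/fset0Pn; exists x; rewrite !inE xC /=.
move=> H Sig uH uSig.
have qX : (q * shift_count X H Sig <= incidences H (G `\ 0%R) Sig S)%N.
  apply: shift_count_le_incidences => //; first exact: fset_uniq.
  by move=> y; rewrite !inE => /andP[].
have G10 : 0 \notin G `\ 0%R by rewrite !inE eqxx.
have := incidences_cube_le uH (fset_uniq _) uSig (fset_uniq _) G10 S0.
rewrite -(ler_nat R) !(natrM, natrX).
have : (q * shift_count X H Sig)%:R ^+ 3 <= (incidences H (G `\ 0%R) Sig S)%:R ^+ 3 :> R.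
  by rewrite lerXn2r ?nnegrE ?ler0n // ler_nat.
move=> /le_trans h /h {h}.
have G1G : #|` G `\ 0|%:R <= #|` G|%:R :> R by rewrite ler_nat fsubset_leq_card ?fsubD1set.
have harm0 : 0 <= harm R #|` C| by apply: sumr_ge0 => k _; rewrite invr_ge0.
have DC0 : 0 < D * #|` C|%:R by rewrite mulr_gt0 ?ltr0n.
move: S_large; rewrite ltr_pdivrMr // => /ltW S_large.
have G2_gt0 : 0 < #|` G|%:R ^+ 2 :> R by rewrite exprn_gt0 ?ltr0n.
have S2_gt0 : 0 < #|` S|%:R ^+ 2 :> R by rewrite exprn_gt0 ?ltr0n.
have := le_trans sum_r qn_large; rewrite natrM -card_X => rich T3.
apply: ler_cube.
  by rewrite mulr_ge0 ?divr_ge0 ?mulr_ge0 ?cbrt_ge0 ?ler0n.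
rewrite !exprMn exprVn !cbrtK ?mulr_ge0 ?exprn_ge0 ?ler0n ?(ltW D0) //.
rewrite natrM in T3.
set u := harm _ _ in harm0 rich *; set T := (shift_count _ _ _)%:R in T3 *.
have T0 : 0 <= T by apply: ler0n.
set a := #|` X|%:R in rich *; set c := #|` C|%:R in DC0 S_large *.
set s := #|` S|%:R in S2_gt0 rich S_large T3 *.
set g := #|` G|%:R in G2_gt0 G1G S_large *; set g1 := #|` G `\ 0|%:R in G1G T3 *.
set w := (size H)%:R ^+ 2 * _.
have w0 : 0 <= w by rewrite mulr_ge0 ?exprn_ge0 ?ler0n.
have a0 : 0 <= a by apply: ler0n.
have s0 : 0 <= s by apply: ler0n.
have cube_rich : tau ^+ 3 * s ^+ 3 <= 8 * (q%:R * a * u) ^+ 3.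
  have -> : 8 * (q%:R * a * u) ^+ 3 = (2 * (q%:R * a * u)) ^+ 3 by ring.
  rewrite -exprMn lerXn2r ?nnegrE ?mulr_ge0 ?ler0n ?(ltW tau0) //.
  by move: rich; lra.
have g12 : g1 ^+ 2 <= g ^+ 2 by rewrite lerXn2r ?nnegrE ?ler0n.
(* Multiply by [s ^ 2], trade [tau * s] for [2 * q * a * u] by richness, then bound [q * T] by
   incidences. This eliminates [q], and [48 = 2 * 24]. *)
have T3s : T ^+ 3 * (tau ^+ 3 * s) <= 48 ^+ 3 * u ^+ 3 * a ^+ 3 * w * g ^+ 2.
  rewrite -(ler_pM2r S2_gt0).
  have e1 : T ^+ 3 * (tau ^+ 3 * s) * s ^+ 2 = T ^+ 3 * (tau ^+ 3 * s ^+ 3) by ring.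
  rewrite e1; apply: (le_trans (ler_wpM2l (exprn_ge0 3 T0) cube_rich)).
  have -> : T ^+ 3 * (8 * (q%:R * a * u) ^+ 3) =
    8 * a ^+ 3 * u ^+ 3 * (q%:R * T) ^+ 3 by ring.
  have k0 : 0 <= 8 * a ^+ 3 * u ^+ 3 by rewrite !mulr_ge0 ?exprn_ge0.
  apply: (le_trans (ler_wpM2l k0 T3)).
  have -> : 8 * a ^+ 3 * u ^+ 3 *
      (24 ^+ 3 * ((size H)%:R * g1 * ((size Sig)%:R * s)) ^+ 2) =
    48 ^+ 3 * u ^+ 3 * a ^+ 3 * w * s ^+ 2 * g1 ^+ 2 by rewrite /w; ring.
  have -> : 48 ^+ 3 * u ^+ 3 * a ^+ 3 * w * g ^+ 2 * s ^+ 2 =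
    48 ^+ 3 * u ^+ 3 * a ^+ 3 * w * s ^+ 2 * g ^+ 2 by ring.
  by rewrite ler_wpM2l // !mulr_ge0 ?exprn_ge0.
rewrite mulrAC ler_pdivlMr // -(ler_pM2r G2_gt0); apply: le_trans T3s.
by rewrite -mulrA [tau ^+ 3 * s]mulrC ler_wpM2l ?exprn_ge0.
Qed.

(** * Decomposition by repeated extraction, and the upper bound *)

Lemma harm_ge0 (R : realType) (n : nat) : 0 <= harm R n.
Proof. by apply: sumr_ge0 => k _; rewrite invr_ge0. Qed.

Lemma le_harm (R : realType) : {homo harm R : m n / (m <= n)%N >-> m <= n}.
Proof.
move=> m n; elim: n => [|n IHn]; first by rewrite leqn0 => /eqP ->.
rewrite leq_eqVlt ltnS => /predU1P[->//|/IHn]; move/le_trans; apply.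
by rewrite [leRHS]/harm big_ord_recr /= lerDl invr_ge0.
Qed.

Lemma harm_le_ln (R : realType) (n : nat) : harm R n.+1 <= 1 + ln n.+1%:R.
Proof.
elim: n => [|n IHn]; first by rewrite /harm big_ord1 invr1 ln1 addr0.
rewrite /harm big_ord_recr /=; move: IHn; rewrite -/(harm R n.+1) => IHn.
have n20 : n.+2%:R != 0 :> R by rewrite pnatr_eq0.
have e : 1 - n.+2%:R^-1 = n.+1%:R / n.+2%:R :> R.
  by apply: (mulIf n20); rewrite mulrBl mulVf // divfK // mul1r -[n.+2%:R]natr1 addrK.
(* This gives [1 / (n + 2) <= ln (n + 2) - ln (n + 1)], the induction step. *)
have := @le_ln1Dx R (- n.+2%:R^-1); rewrite e ln_div ?posrE ?ltr0n //.
have -> : -1 < - n.+2%:R^-1 :> R.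
  by rewrite ltrN2 invf_lt1 ?ltr0n // ltr1n.
move=> /(_ isT); move: IHn.
move: (harm _ _) (ln n.+1%:R) (ln n.+2%:R) (n.+2%:R^-1) => a b c d; lra.
Qed.

Lemma le_spread (R : realType) (X : {fset R}) (a b : R) :
  a <= b -> spread X a -> spread X b.
Proof.
move=> ab Xa G S uG uS; apply: le_trans (Xa G S uG uS) _.
by rewrite ler_wpM2r ?cbrt_ge0.
Qed.

(** The tangent line inequality for the concave function [t^(2/3)] at [t = u ^ 3], scaled by 3/2. It
    makes the costs of successive extractions telescope. *)
Lemma cbrt_sqr_gain (R : realType) (u v : R) : 0 < u -> 0 <= v -> v <= u ->
  (u ^+ 3 - v ^+ 3) / u + 3 / 2 * v ^+ 2 <= 3 / 2 * u ^+ 2.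
Proof.
move=> u0 v0 vu; rewrite -lerBrDr ler_pdivrMr //.
(* After clearing [u], twice the difference of the two sides is [(u - v)^2 (u + 2 v)]. *)
have : 0 <= (u - v) * ((u - v) * (u + 2 * v)).
  by rewrite !mulr_ge0 ?subr_ge0 ?addr_ge0 // ?mulr_ge0 // ltW.
lra.
Qed.

(** Induction on the size of [C]: extract a spread [X], recurse on the rest, and put [X] into [B].
    The fixed [N] gives all stages a common harmonic factor, and [72 = 48 * 3 / 2] with 3/2 from
    [cbrt_sqr_gain]. *)
Lemma exists_decomposition (R : realType) (D : R) (N : nat) (C : {fset R}) :
  8 <= D -> (#|` C| <= N)%N ->
  exists B C' : {fset R}, [/\ B `|` C' = C, [disjoint B & C'], Dtimes_bound C' D &
    spread B (72 * harm R N / cbrt D * cbrt #|` B|%:R ^+ 2)].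
Proof.
move=> D8; have D0 : 0 < D by apply: lt_le_trans D8.
have cD0 : 0 < cbrt D := cbrt_gt0 D0.
move: {2}#|` C| (leqnn #|` C|) => m; elim: m C => [|m IHm] C Cm CN.
all: have [CD|/(exists_spread_subset D8)[X [XC X_n0 X_spread]]] :=
  pselect (Dtimes_bound C D).
all: try (exists fset0, C; split=> //; rewrite ?fset0U //; first exact: fdisjoint0X;
  by move=> G S uG uS; rewrite /shift_count; under eq_bigr do rewrite big_seq_fset0;
     rewrite big1 // mulr_ge0 ?cbrt_ge0 // mulr_ge0 ?exprn_ge0 ?cbrt_ge0 //
       divr_ge0 ?cbrt_ge0 // mulr_ge0 ?harm_ge0).
  (* Base case: the empty [C] has no nonempty subset [X]. *)
  have := fsubset_leq_card XC; rewrite (eqP (_ : #|` C| == 0%N)) -?leqn0 //.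
  by rewrite leqNgt cardfs_gt0 X_n0.
have X_gt0 : (0 < #|` X|)%N by rewrite cardfs_gt0.
have cardC : #|` C| = (#|` X| + #|` C `\` X|)%N.
  by rewrite cardfsDS // subnKC // fsubset_leq_card.
have [||B [C' [BC' disjBC' C'D B_spread]]] := IHm (C `\` X); try by move: cardC; lia.
have BC : B `<=` C `\` X by rewrite -BC' fsubsetUl.
have disjXB : [disjoint X & B].
  apply/fdisjointP => x xX; apply/negP => xB.
  by move/fsubsetP: BC => /(_ x xB); rewrite inE xX.
have card_XB : #|` X `|` B| = (#|` X| + #|` B|)%N.
  by rewrite cardfsU (eqP (_ : X `&` B == fset0)) ?cardfs0 ?subn0 // -fsetI_eq0.
exists (X `|` B), C'; split=> //.
- rewrite -fsetUA BC'; apply/fsetP => x; rewrite !inE.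
  by case: (boolP (x \in X)) => //= /(fsubsetP XC).
- rewrite fdisjointUX disjBC' andbT; apply/fdisjointP => x xX; apply/negP => xC'.
  by have := fsubsetUr B C' => /fsubsetP/(_ x xC'); rewrite BC' inE xX.
apply: le_spread (spreadU disjXB X_spread B_spread).
set u := cbrt #|` X `|` B|%:R; set v := cbrt #|` B|%:R.
have u0 : 0 < u by rewrite cbrt_gt0 // ltr0n card_XB; lia.
have v0 : 0 <= v := cbrt_ge0 _.
have vu : v <= u by rewrite le_cbrt ?ler0n // ler_nat card_XB leq_addl.
(* The extraction cost has [cbrt |C|] in the denominator; replacing it by the smaller [u] makes
   [cbrt_sqr_gain] applicable. *)
have uC : u <= cbrt #|` C|%:R.
  rewrite le_cbrt ?ler0n // ler_nat card_XB cardC leq_add2l.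
  exact: fsubset_leq_card.
have Xuv : #|` X|%:R = u ^+ 3 - v ^+ 3 by rewrite !cbrtK // card_XB natrD addrK.
rewrite cbrtM ?ler0n ?(ltW D0) // {1}Xuv.
have uv0 : 0 <= u ^+ 3 - v ^+ 3 by rewrite -Xuv.
apply: (@le_trans _ _ (48 * harm R N / cbrt D *
   ((u ^+ 3 - v ^+ 3) / u + 3 / 2 * v ^+ 2))); last first.
  have -> : 72 * harm R N / cbrt D * u ^+ 2 =
     48 * harm R N / cbrt D * (3 / 2 * u ^+ 2) by field; rewrite gt_eqF.
  by rewrite ler_wpM2l ?cbrt_sqr_gain // divr_ge0 ?(ltW cD0) // mulr_ge0 ?harm_ge0.
rewrite [leRHS]mulrDr; apply: lerD; last first.
  by rewrite le_eqVlt; apply/orP; left; apply/eqP; field; rewrite gt_eqF.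
have cC0 := lt_le_trans u0 uC.
have -> : 48 * harm R #|` C| * (u ^+ 3 - v ^+ 3) / (cbrt D * cbrt #|` C|%:R) =
    48 / cbrt D * (harm R #|` C| * ((u ^+ 3 - v ^+ 3) / cbrt #|` C|%:R)).
  by field; rewrite !gt_eqF.
have -> : 48 * harm R N / cbrt D * ((u ^+ 3 - v ^+ 3) / u) =
    48 / cbrt D * (harm R N * ((u ^+ 3 - v ^+ 3) / u)).
  by field; rewrite !gt_eqF.
rewrite ler_wpM2l ?divr_ge0 ?(ltW cD0) // ler_pM ?harm_ge0 ?le_harm //.
  by rewrite divr_ge0 // ltW.
by rewrite ler_wpM2l // lef_pV2.
Qed.

Lemma Dplus_le (R : realType) (X : {fset R}) (D : R) :
  0 < D -> Dplus_bound X D -> Dplus X <= D.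
Proof. by move=> D0 XD; apply: ge_inf => //; exists 0 => x [/ltW]. Qed.

Lemma Dtimes_le (R : realType) (X : {fset R}) (D : R) :
  0 < D -> Dtimes_bound X D -> Dtimes X <= D.
Proof. by move=> D0 XD; apply: ge_inf => //; exists 0 => x [/ltW]. Qed.

Lemma decomposition_bound (R : realType) : exists K c : R, [/\ 0 < K, 0 < c &
  forall A : {fset R}, (2 <= #|` A|)%N ->
  exists B C : {fset R},
    [/\ B `|` C = A, [disjoint B & C] &
        Num.max (Dplus B) (Dtimes C)
          <= K * #|` A|%:R `^ (1 - 2 / 5) * ln #|` A|%:R `^ c]].
Proof.
have ln2 : 0 < ln 2 :> R by rewrite ln_gt0 // ltr1n.
(* Chosen so that [1 + ln n <= k * ln n] for all [n >= 2]. *)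
pose k : R := 1 + (ln 2)^-1.
have k0 : 0 < k by rewrite addr_gt0 ?invr_gt0.
(* The log exponent 3 arises from cubing the [spread] constant, which has one harmonic factor. *)
exists (72 ^+ 3 * k ^+ 3), 3; split=> //; first by rewrite mulr_gt0 ?exprn_gt0.
move=> A A2; set n : R := #|` A|%:R.
have n2 : 2 <= n by rewrite ler_nat.
have n0 : 0 < n by apply: lt_le_trans n2.
have n1 : 1 <= n by apply: le_trans n2; rewrite ler1n.
set P := n `^ (1 - 2 / 5).
have P1 : 1 <= P by rewrite -(powRr0 n) ler_powR //; lra.
(* The exponent 3/5 is at least 1/2, so [n / P], the order of the bound for [Dplus B], is at most
   [P]. *)
have nP : n <= P * P.
  rewrite -powRD ?(gt_eqF n0) ?implybT // -{1}(powRr1 (ltW n0)) ler_powR //; lra.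
have lnn : ln 2 <= ln n by rewrite ler_ln ?posrE.
have D8 : 8 <= 8 * P by rewrite ler_peMr.
have [B [C [BC disjBC CD B_spread]]] := exists_decomposition D8 (leqnn #|` A|).
exists B, C; split=> //; rewrite powR_mulrn ?ln_ge0 //.
have h0 := harm_ge0 R #|` A|.
have hln : harm R #|` A| <= k * ln n.
  have := harm_le_ln R #|` A|.-1; rewrite prednK ?(ltnW A2) // -/n => /le_trans; apply.
  by rewrite mulrDl mul1r addrC lerD2l ler_pdivlMl // mulr1.
have kln : 1 <= k * ln n.
  apply: (@le_trans _ _ (k * ln 2)); last by rewrite ler_wpM2l // ltW.
  by rewrite mulrDl mulVf ?gt_eqF // mul1r lerDr ltW.
have kln3 : 1 <= (k * ln n) ^+ 3 by rewrite exprn_ege1.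
have -> : 72 ^+ 3 * k ^+ 3 * P * ln n ^+ 3 = 72 ^+ 3 * P * (k * ln n) ^+ 3 by ring.
have P0 : 0 < P by apply: lt_le_trans P1.
rewrite ge_max; apply/andP; split; last first.
  apply: (le_trans (Dtimes_le _ CD)); first by rewrite mulr_gt0.
  rewrite -[leLHS]mulr1 ler_pM ?mulr_ge0 ?(ltW P0) // ler_wpM2r ?(ltW P0) //.
  by rewrite -natrX ler_nat.
apply: Dplus_le; first by rewrite !mulr_gt0 ?exprn_gt0 ?mulr_gt0 // (lt_le_trans ln2).
apply: (spread_Dplus_bound _ B_spread).
  by rewrite mulr_ge0 ?exprn_ge0 ?cbrt_ge0 // divr_ge0 ?cbrt_ge0 // mulr_ge0.
have Bn : #|` B|%:R <= n by rewrite ler_nat -BC fsubset_leq_card ?fsubsetUl.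
have h3 : harm R #|` A| ^+ 3 <= (k * ln n) ^+ 3.
  by rewrite lerXn2r ?nnegrE // (le_trans _ kln).
have cP0 : 0 < cbrt (8 * P) by rewrite cbrt_gt0 ?mulr_gt0.
(* The cubed constant contains [|B| ^ 2]; one factor [|B|] is the one in [spread_Dplus_bound], the
   other is at most [n <= P * P]. *)
have -> : (72 * harm R #|` A| / cbrt (8 * P) * cbrt #|` B|%:R ^+ 2) ^+ 3 =
    72 ^+ 3 * harm R #|` A| ^+ 3 / cbrt (8 * P) ^+ 3 *
    (cbrt #|` B|%:R ^+ 3 * cbrt #|` B|%:R ^+ 3) by field; rewrite gt_eqF.
rewrite !cbrtK ?mulr_ge0 ?(ltW P0) ?ler0n //.
set b : R := #|` B|%:R in Bn *; set L := (k * ln n) ^+ 3 in h3 *.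
have b0 : 0 <= b by apply: ler0n.
have -> : 72 ^+ 3 * harm R #|` A| ^+ 3 / (8 * P) * (b * b) =
    72 ^+ 3 * b * (harm R #|` A| ^+ 3 * (b / (8 * P))) by field; rewrite gt_eqF.
have -> : 72 ^+ 3 * P * L * b = 72 ^+ 3 * b * (L * P) by ring.
rewrite ler_wpM2l ?mulr_ge0 ?exprn_ge0 // ler_pM ?exprn_ge0 ?divr_ge0 ?mulr_ge0 ?(ltW P0) //.
rewrite ler_pdivrMr ?mulr_gt0 //; apply: (le_trans Bn); apply: (le_trans nP).
by rewrite mulrCA ler_peMl ?mulr_ge0 ?(ltW P0) // ler1n.
Qed.

(** * Lower bounds for [Dplus] and [Dtimes] from witnesses *)

(** Provides an admissible constant, so that lower bounds pass to [inf], whose set must be nonempty.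
    The summand 1 keeps the constant positive for empty [X]. *)
Lemma crude_level_bound (R : realType) (X G S : {fset R}) (tau : R) :
  0 < tau -> (#|` S| <= #|` X| * #|` G|)%N ->
  {in S, forall s, tau <= #|` X|%:R} ->
  #|` S|%:R <= (#|` X|%:R ^+ 3 + 1) * #|` X|%:R * #|` G|%:R ^+ 2 / tau ^+ 3.
Proof.
move=> tau0 SXG tauX; rewrite ler_pdivlMr ?exprn_gt0 //.
have [->|/fset0Pn[s sS]] := eqVneq S fset0.
  by rewrite cardfs0 mul0r !mulr_ge0 ?addr_ge0 ?exprn_ge0.
apply: (@le_trans _ _ ((#|` X| * #|` G|)%:R * #|` X|%:R ^+ 3)).
  by rewrite ler_pM ?exprn_ge0 ?ler_nat ?(ltW tau0) // lerXn2r ?nnegrE ?(ltW tau0) ?(tauX s).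
rewrite natrM mulrC mulrA ler_pM ?mulr_ge0 ?exprn_ge0 // ?ler_wpM2r ?lerDl //.
by rewrite -natrX ler_nat; case: #|` G| => // g; rewrite leq_pmulr.
Qed.

Lemma card_diff_fset (R : realType) (X G : {fset R}) :
  (#|` diff_fset X G| <= #|` X| * #|` G|)%N.
Proof.
rewrite -(size_allpairs (fun x g => x - g) X G); apply: uniq_leq_size => // y.
by case/imfset2P=> x /= xX [g /= gG] ->; apply/allpairsP; exists (x, g).
Qed.

Lemma le_Dplus (R : realType) (X : {fset R}) (v : R) :
  (forall D, 0 < D -> Dplus_bound X D -> v <= D) -> v <= Dplus X.
Proof.
move=> vD; apply: lb_le_inf => [|D [D0 XD]]; last exact: vD.
exists (#|` X|%:R ^+ 3 + 1); split=> [|G tau tau1]; first by rewrite ltr_wpDl ?exprn_ge0.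
apply: crude_level_bound; first exact: lt_le_trans tau1.
  apply: leq_trans (card_diff_fset X G); apply: fsubset_leq_card.
  by apply/fsubsetP=> s; rewrite !inE => /andP[].
move=> s; rewrite !inE => /andP[_] /le_trans; apply.
by rewrite ler_nat fsubset_leq_card ?fsubsetIl.
Qed.

Lemma le_Dtimes (R : realType) (X : {fset R}) (v : R) :
  (forall D, 0 < D -> Dtimes_bound X D -> v <= D) -> v <= Dtimes X.
Proof.
move=> vD; apply: lb_le_inf => [|D [D0 XD]]; last exact: vD.
exists (#|` X|%:R ^+ 3 + 1); split=> [|G tau tau1]; first by rewrite ltr_wpDl ?exprn_ge0.
apply: crude_level_bound; first exact: lt_le_trans tau1.
  apply: leq_trans (card_quot_fset X G); apply: fsubset_leq_card.
  by apply/fsubsetP=> s; rewrite !inE => /andP[].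
move=> s; rewrite !inE => /andP[_] /le_trans; apply.
by rewrite ler_nat fsubset_leq_card ?fsubsetIl.
Qed.

(** Explicit shifts with many witnesses [Y] bound the level set from below. As [Y] is nonempty, each
    such [s] does lie in [diff_fset X G]. *)
Lemma Dplus_bound_rich (R : realType) (X G : {fset R}) (S : seq R) (D tau : R) :
  Dplus_bound X D -> 1 <= tau -> uniq S ->
  {in S, forall s, exists Y : seq R, [/\ uniq Y, {subset Y <= X},
     {in Y, forall y, y - s \in G} & tau <= (size Y)%:R]} ->
  (size S)%:R * tau ^+ 3 <= D * #|` X|%:R * #|` G|%:R ^+ 2.
Proof.
move=> XD tau1 uS S_rich; have tau0 : 0 < tau by apply: lt_le_trans tau1.
rewrite -ler_pdivlMr ?exprn_gt0 //; apply: le_trans (XD G tau tau1).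
rewrite ler_nat; apply: uniq_leq_size => // s sS.
have [Y [uY YX YG tauY]] := S_rich s sS; rewrite !inE; apply/andP; split.
  have : (0 < size Y)%N by rewrite -(ltr_nat R); apply: lt_le_trans tauY.
  case: Y YX YG {uY tauY} => // y Y YX YG _; apply/imfset2P.
  exists y; first by apply: YX; rewrite mem_head.
  by exists (y - s); rewrite ?subKr //; apply: YG; rewrite mem_head.
apply: le_trans tauY _; rewrite ler_nat; apply: uniq_leq_size => // y yY.
rewrite in_fsetI YX //=; apply/imfsetP; exists (y - s); rewrite ?subrK //.
exact: YG.
Qed.

Lemma Dtimes_bound_rich (R : realType) (X G : {fset R}) (S : seq R) (D tau : R) :
  Dtimes_bound X D -> 1 <= tau -> uniq S -> 0 \notin S -> 0 \notin G ->
  {in S, forall s, exists Y : seq R, [/\ uniq Y, {subset Y <= X},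
     {in Y, forall y, y / s \in G} & tau <= (size Y)%:R]} ->
  (size S)%:R * tau ^+ 3 <= D * #|` X|%:R * #|` G|%:R ^+ 2.
Proof.
move=> XD tau1 uS S0 G0 S_rich; have tau0 : 0 < tau by apply: lt_le_trans tau1.
rewrite -ler_pdivlMr ?exprn_gt0 //; apply: le_trans (XD G tau tau1).
rewrite ler_nat; apply: uniq_leq_size => // s sS.
have s0 : s != 0 := memPn S0 _ sS.
have [Y [uY YX YG tauY]] := S_rich s sS; rewrite !inE; apply/andP; split.
  have : (0 < size Y)%N by rewrite -(ltr_nat R); apply: lt_le_trans tauY.
  case: Y YX YG {uY tauY} => // y Y YX YG _; apply/imfset2P.
  have ysG : y / s \in G by apply: YG; rewrite mem_head.
  exists y; first by apply: YX; rewrite mem_head.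
  exists (y / s); first by rewrite !inE ysG (memPn G0).
  rewrite invf_div mulrCA divff ?mulr1 //.
  by apply: contraNneq (memPn G0 _ ysG) => ->; rewrite mul0r.
apply: le_trans tauY _; rewrite ler_nat; apply: uniq_leq_size => // y yY.
rewrite in_fsetI YX //=; apply/imfsetP; exists (y / s); first exact: YG.
by rewrite mulrCA divff ?mulr1.
Qed.

(** * The dyadic grid *)

(** All [P + i] lie in [[P, 2P)], so distinct powers of 2 move them into disjoint ranges. *)
Lemma dyadic_block_inj (P i i' u v : nat) : (i < P)%N -> (i' < P)%N ->
  ((P + i) * 2 ^ u = (P + i') * 2 ^ v)%N -> i = i' /\ u = v.
Proof.
move=> iP i'P e.
have lt_pow j j' x y : (j' < P)%N -> (x < y)%N -> ((P + j') * 2 ^ x < (P + j) * 2 ^ y)%N.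
  move=> jP xy; apply: (@leq_trans (P * 2 ^ x.+1)).
    by rewrite expnS mulnCA mulnA ltn_pmul2r ?expn_gt0 //; lia.
  by rewrite leq_mul ?leq_addr // leq_pexp2l.
case: (ltngtP u v) => uv.
- by have := lt_pow i' i _ _ iP uv; rewrite e ltnn.
- by have := lt_pow i i' _ _ i'P uv; rewrite e ltnn.
- by split=> //; move/eqP: e; rewrite uv eqn_pmul2r ?expn_gt0 // eqn_add2l => /eqP.
Qed.

Definition dyadic (R : realType) (P i j : nat) : R := ((P + i) * 2 ^ j)%:R.

Definition dyadic_grid (R : realType) (P Q : nat) : {fset R} :=
  [fset x in [seq dyadic R P i j | i <- iota 0 P, j <- iota 0 Q]].

Lemma dyadic_inj (R : realType) (P i i' j j' : nat) : (i < P)%N -> (i' < P)%N ->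
  dyadic R P i j = dyadic R P i' j' -> i = i' /\ j = j'.
Proof.
by move=> iP i'P /eqP; rewrite eqr_nat => /eqP; apply: dyadic_block_inj.
Qed.

Lemma card_fset_seq_le (T : choiceType) (s : seq T) : (#|` [fset x in s]| <= size s)%N.
Proof. by rewrite card_fseq size_undup. Qed.

Lemma card_dyadic_grid_le (R : realType) (P Q : nat) :
  (#|` dyadic_grid R P Q| <= P * Q)%N.
Proof.
by rewrite (leq_trans (card_fset_seq_le _)) // size_allpairs !size_iota.
Qed.

Lemma dyadic_in_grid (R : realType) (P Q i j : nat) : (i < P)%N -> (j < Q)%N ->
  dyadic R P i j \in dyadic_grid R P Q.
Proof.
by move=> iP jQ; rewrite inE /=; apply/allpairsP; exists (i, j); rewrite !mem_iota.
Qed.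

(** The row is a progression of step [2 ^ j]. Each of the [P] shifts in [S] carries it into the
    progression [G] of length [2 * P], so all are [P / 2]-rich. *)
Lemma Dplus_bound_dyadic_row (R : realType) (P j : nat) (X : {fset R}) (D : R) :
  (2 <= P)%N -> Dplus_bound X D -> 0 < D ->
  (P <= 2 * \sum_(i <- iota 0 P) (dyadic R P i j \in X))%N ->
  P%:R ^+ 2 <= 32 * D * #|` X|%:R.
Proof.
move=> P2 XD D0 X_row.
pose G : {fset R} := [fset x in [seq (t * 2 ^ j)%:R : R | t <- iota 0 (2 * P)]].
pose S := [seq (u.+1 * 2 ^ j)%:R : R | u <- iota 0 P].
have cardG : (#|` G| <= 2 * P)%N.
  by apply: leq_trans (card_fset_seq_le _) _; rewrite size_map size_iota.
have pow0 : (2 ^ j != 0)%N by rewrite -lt0n expn_gt0.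
have uS : uniq S.
  rewrite map_inj_uniq ?iota_uniq // => u v /eqP.
  by rewrite eqr_nat eqn_mul2r (negPf pow0) => /eqP [].
(* Shifts run over [u.+1 <= P], so [P + i - u.+1] is not truncated and stays below [2 * P]. *)
have aux (p a b : nat) : (a < p -> b < p -> p + a - b.+1 < 2 * p)%N by lia.
have half1 : 1 <= P%:R / 2 :> R by rewrite ler_pdivlMr // mul1r ler_nat.
have S_rich : {in S, forall s, exists Y : seq R, [/\ uniq Y, {subset Y <= X},
    {in Y, forall y, y - s \in G} & P%:R / 2 <= (size Y)%:R :> R]}.
  move=> s; rewrite /S; move=> /mapP[u]; rewrite mem_iota /= add0n => uP ->.
  exists [seq dyadic R P i j | i <- iota 0 P & dyadic R P i j \in X]; split.
  - rewrite map_inj_in_uniq ?filter_uniq ?iota_uniq // => i i'.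
    rewrite !mem_filter !mem_iota /= !add0n => /andP[_ iP] /andP[_ i'P].
    by case/(dyadic_inj iP i'P).
  - by move=> y /mapP[i]; rewrite mem_filter => /andP[iX _] ->.
  - move=> y /mapP[i]; rewrite mem_filter mem_iota /= add0n => /andP[_ iP] ->.
    rewrite inE /= /dyadic -natrB; last by rewrite leq_mul2r; apply/orP; right; lia.
    rewrite -mulnBl; apply/mapP; exists (P + i - u.+1)%N => //.
    by rewrite mem_iota /= add0n aux.
  - rewrite size_map -sum_nat_bool ler_pdivrMr // mulrC -natrM ler_nat; exact: X_row.
have := Dplus_bound_rich XD half1 uS S_rich; rewrite size_map size_iota => h.
have P0 : 0 < P%:R ^+ 2 :> R by rewrite exprn_gt0 // ltr0n; lia.
have {h} : P%:R * (P%:R / 2) ^+ 3 <= D * #|` X|%:R * (2 * P%:R) ^+ 2.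
  apply: (le_trans h); rewrite ler_wpM2l ?mulr_ge0 ?(ltW D0) //.
  by rewrite lerXn2r ?nnegrE ?mulr_ge0 // -natrM ler_nat.
move=> h; rewrite -(ler_pM2r P0).
move: (P%:R : R) (#|` X|%:R : R) h => p x h.
have e : 8 * (p * (p / 2) ^+ 3) = p ^+ 2 * p ^+ 2 by field.
rewrite -e (_ : 32 * D * x * p ^+ 2 = 8 * (D * x * (2 * p) ^+ 2)); last by ring.
by rewrite ler_wpM2l.
Qed.

(** Averaging over rows finds at least [P / 4] columns with a quarter of their points in [X]. The
    dilations [(P + i) / 2 ^ u] carry column [i] into the powers of 2 in [G], and different columns
    use different dilations. *)
Lemma Dtimes_bound_dyadic_columns (R : realType) (P Q : nat) (X : {fset R}) (D : R) :
  (0 < P)%N -> (4 <= Q)%N -> Dtimes_bound X D -> 0 < D ->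
  {in iota 0 Q, forall j,
     (P <= 2 * \sum_(i <- iota 0 P) (dyadic R P i j \in X))%N} ->
  P%:R * Q%:R ^+ 2 <= 1024 * D * #|` X|%:R.
Proof.
move=> P0 Q4 XD D0 X_rows.
pose d i := (\sum_(j <- iota 0 Q) (dyadic R P i j \in X))%N.
pose I := [seq i <- iota 0 P | (Q <= 4 * d i)%N].
have I_large : (P <= 4 * size I)%N.
  have rows : (Q * P <= 2 * \sum_(i <- iota 0 P) d i)%N.
    rewrite exchange_big big_distrr /= -{1}(size_iota 0 Q).
    exact: size_leq_sum.
  (* A column outside [I] contributes at most [Q / 4], one inside at most [Q]. *)
  have cols : (4 * \sum_(i <- iota 0 P) d i <= 4 * Q * size I + P * Q)%N.
    have -> : (P * Q = \sum_(i <- iota 0 P) Q)%N.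
      by rewrite big_const_seq count_predT iter_addn_0 size_iota mulnC.
    rewrite -sum_nat_bool big_distrr [(4 * Q * _)%N]big_distrr -big_split /=.
    apply: leq_sum => i _; have dQ : (d i <= Q)%N.
      rewrite /d sum_nat_bool size_filter (leq_trans (count_size _ _)) //.
      by rewrite size_iota.
    by case: leqP => /=; lia.
  by rewrite -(leq_pmul2l (_ : 0 < Q)%N); lia.
pose G : {fset R} := [fset x in [seq 2 ^+ t : R | t <- iota 0 (2 * Q)]].
pose S := [seq (P + i)%:R / 2 ^+ u : R | i <- I, u <- iota 0 Q].
have cardG : (#|` G| <= 2 * Q)%N.
  by apply: leq_trans (card_fset_seq_le _) _; rewrite size_map size_iota.
have pow0 t : 2 ^+ t != 0 :> R by rewrite expf_neq0 ?pnatr_eq0.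
have IP i : i \in I -> (i < P)%N by rewrite mem_filter mem_iota => /andP[_].
have uS : uniq S.
  apply: allpairs_uniq; rewrite ?filter_uniq ?iota_uniq // => -[i u] [i' u'].
  case/allpairsP=> -[i1 u1] /= [i1I _ [-> ->]] {i u}.
  case/allpairsP=> -[i2 u2] /= [i2I _ [-> ->]] {i' u'} /= /eqP.
  (* Cross-multiplying turns equality of dilations into equality of grid points. *)
  rewrite eqr_div // -!natrX -!natrM eqr_nat => /eqP.
  by case/(dyadic_block_inj (IP _ i1I) (IP _ i2I)) => -> ->.
have S0 : 0 \notin S.
  apply/negP; rewrite /S => /allpairsP[[i u] /= [_ _ /esym/eqP]].
  by rewrite mulf_eq0 invr_eq0 (negPf (pow0 _)) orbF pnatr_eq0; lia.
have G0 : 0 \notin G.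
  by rewrite inE /=; apply/negP => /mapP[t _ /esym/eqP]; apply/negP.
have quarter1 : 1 <= Q%:R / 4 :> R by rewrite ler_pdivlMr // mul1r ler_nat.
have S_rich : {in S, forall s, exists Y : seq R, [/\ uniq Y, {subset Y <= X},
    {in Y, forall y, y / s \in G} & Q%:R / 4 <= (size Y)%:R :> R]}.
  move=> s; rewrite /S => /allpairsP[[i u] /= [iI uQ ->]].
  have iP := IP i iI.
  exists [seq dyadic R P i j | j <- iota 0 Q & dyadic R P i j \in X]; split.
  - rewrite map_inj_uniq ?filter_uniq ?iota_uniq // => j j'.
    by case/(dyadic_inj iP iP).
  - by move=> y /mapP[j]; rewrite mem_filter => /andP[jX _] ->.
  - move=> y /mapP[j]; rewrite mem_filter mem_iota /= add0n => /andP[_ jQ] ->.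
    rewrite inE /=; apply/mapP; exists (j + u)%N.
      by move: uQ; rewrite !mem_iota; lia.
    rewrite /dyadic natrM natrX exprD; field.
    by rewrite pow0 -natrD pnatr_eq0; lia.
  - rewrite size_map -sum_nat_bool ler_pdivrMr // mulrC -natrM ler_nat.
    by move: iI; rewrite mem_filter => /andP[].
have := Dtimes_bound_rich XD quarter1 uS S0 G0 S_rich.
rewrite size_allpairs size_iota => h.
have Q0 : 0 < Q%:R ^+ 2 :> R by rewrite exprn_gt0 // ltr0n; lia.
have {h} : (size I * Q)%:R * (Q%:R / 4) ^+ 3 <= D * #|` X|%:R * (2 * Q%:R) ^+ 2.
  apply: (le_trans h); rewrite ler_wpM2l ?mulr_ge0 ?(ltW D0) //.
  by rewrite lerXn2r ?nnegrE ?mulr_ge0 // -natrM ler_nat.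
have : P%:R <= 4 * (size I)%:R :> R by rewrite -natrM ler_nat.
move=> PI h; rewrite -(ler_pM2r Q0).
have : P%:R * Q%:R ^+ 4 <= 4 * (size I)%:R * Q%:R ^+ 4 :> R by rewrite ler_wpM2r ?exprn_ge0.
move: h; rewrite natrM -[P%:R * _ * _]mulrA -exprD.
move: (P%:R : R) (Q%:R : R) (#|` X|%:R : R) ((size I)%:R : R) => p q x y h pq.
apply: (le_trans pq).
have -> : 4 * y * q ^+ 4 = 256 * (y * q * (q / 4) ^+ 3) by field.
rewrite (_ : 1024 * D * x * q ^+ 2 = 256 * (D * x * (2 * q) ^+ 2)); last by ring.
by rewrite ler_wpM2l.
Qed.

(** Since [|B|] and [|C|] are at most [P * Q], a half-full row in [B] forces
    [D >= P / (32 Q) = Q / 32], and otherwise the columns force [D >= Q / 1024]. *)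
Lemma dyadic_grid_lower (R : realType) (Q : nat) (B C : {fset R}) :
  (4 <= Q)%N -> B `|` C = dyadic_grid R (Q ^ 2) Q ->
  Q%:R / 1024 <= Num.max (Dplus B) (Dtimes C).
Proof.
move=> Q4 BC; set P := (Q ^ 2)%N in BC.
have Q0 : 0 < Q%:R :> R by rewrite ltr0n; lia.
have PQ2 : P%:R = Q%:R ^+ 2 :> R by rewrite natrX.
have P2 : (2 <= P)%N by rewrite /P; apply: (@leq_trans Q); rewrite ?leq_pmulr //; lia.
have P0 : 0 < P%:R :> R by rewrite ltr0n; lia.
have cardPQ (X : {fset R}) : X `<=` B `|` C -> #|` X|%:R <= P%:R * Q%:R :> R.
  move=> XBC; rewrite -natrM ler_nat; apply: leq_trans (card_dyadic_grid_le R P Q).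
  by rewrite -BC fsubset_leq_card.
have [[j jQ B_row]|no_row] := pselect (exists2 j, (j < Q)%N &
    (P <= 2 * \sum_(i <- iota 0 P) (dyadic R P i j \in B))%N).
  rewrite le_max; apply/orP; left; apply: le_Dplus => D D0 BD.
  have := Dplus_bound_dyadic_row P2 BD D0 B_row.
  have D32 : 0 <= 32 * D by rewrite mulr_ge0 // ltW.
  move=> /le_trans/(_ (ler_wpM2l D32 (cardPQ B (fsubsetUl _ _)))).
  rewrite mulrCA expr2 ler_pM2l // PQ2 expr2 ler_pM2r // ler_pdivrMr //; lra.
rewrite le_max; apply/orP; right; apply: le_Dtimes => D D0 CD.
have C_rows : {in iota 0 Q, forall j,
     (P <= 2 * \sum_(i <- iota 0 P) (dyadic R P i j \in C))%N}.
  move=> j; rewrite mem_iota /= add0n => jQ.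
  have : ~~ (P <= 2 * \sum_(i <- iota 0 P) (dyadic R P i j \in B))%N.
    by apply/negP => B_row; apply: no_row; exists j.
  have : (P <= \sum_(i <- iota 0 P) (dyadic R P i j \in B) +
               \sum_(i <- iota 0 P) (dyadic R P i j \in C))%N.
    rewrite -big_split /= -{1}(muln1 P) -{1}(size_iota 0 P); apply: size_leq_sum => i.
    rewrite mem_iota /= add0n => iP; have := dyadic_in_grid R iP jQ.
    by rewrite -BC in_fsetU => /orP[] ->; rewrite ?leq_addl ?leq_addr.
  rewrite -ltnNge; move: (\sum_(i <- _) (_ \in B))%N => b.
  by move: (\sum_(i <- _) _)%N => k; lia.
have P_gt0 : (0 < P)%N by lia.
have := Dtimes_bound_dyadic_columns P_gt0 Q4 CD D0 C_rows.
have D1024 : 0 <= 1024 * D by rewrite mulr_ge0 // ltW.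
move=> /le_trans/(_ (ler_wpM2l D1024 (cardPQ C (fsubsetUr _ _)))).
rewrite [1024 * D * _]mulrCA ler_pM2l // expr2 ler_pM2r // ler_pdivrMr //; lra.
Qed.

Lemma card_dyadic_grid_ge2 (R : realType) (P Q : nat) :
  (0 < P)%N -> (2 <= Q)%N -> (2 <= #|` dyadic_grid R P Q|)%N.
Proof.
move=> P0 Q2; have Q0 : (0 < Q)%N by lia.
apply: (@leq_trans #|` [fset dyadic R P 0 0; dyadic R P 0 1]|).
  by rewrite cardfs2; case: eqP => // /(dyadic_inj P0 P0)[].
apply: fsubset_leq_card; apply/fsubsetP => x.
by rewrite in_fset2 => /orP[] /eqP ->; apply: dyadic_in_grid.
Qed.

(** * Failure for exponents above 3/4 *)

(** With [y = Q^(1/8)] and [|A| <= Q ^ 3], the power of [|A|] costs at most [y ^ 6], the logarithm a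
    constant times [y], and the last factor [y] of [Q = y ^ 8] beats all constants, collected in
    [M]. *)
Lemma decomposition_lower (R : realType) (delta K c : R) :
  3 / 4 < delta -> 0 < K -> 0 < c ->
  exists A : {fset R}, (2 <= #|` A|)%N /\
  forall B C : {fset R}, B `|` C = A -> [disjoint B & C] ->
    K * #|` A|%:R `^ (1 - delta) * ln #|` A|%:R `^ c
      < Num.max (Dplus B) (Dtimes C).
Proof.
move=> delta34 K0 c0.
pose M : R := 1024 * K * (24 * c) `^ c.
have M0 : 0 < M by rewrite !mulr_gt0 // powR_gt0 // mulr_gt0.
have [Q Q4 qM] : exists2 Q : nat, (4 <= Q)%N & M ^+ 8 < Q%:R.
  exists (Num.truncn (M ^+ 8)).+4 => //; apply: lt_le_trans (truncnS_gt _) _.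
  by rewrite ler_nat; do 3!apply: leqW.
have [q qE] : exists q : R, q = Q%:R by exists Q%:R.
rewrite -qE in qM.
have q0 : 0 < q by rewrite qE ltr0n; apply: leq_trans Q4.
have [y yE] : exists y, y = q `^ 8^-1 by exists (q `^ 8^-1).
have y0 : 0 < y by rewrite yE powR_gt0.
have y8 : y ^+ 8 = q by rewrite yE -powR_mulrn ?powR_ge0 // -powRrM mulVf ?pnatr_eq0 // powRr1 // ltW.
have yM : M < y by rewrite -(ltr_pXn2r (n := 8)) ?nnegrE ?ltW // y8.
exists (dyadic_grid R (Q ^ 2) Q).
have A2 : (2 <= #|` dyadic_grid R (Q ^ 2) Q|)%N.
  by apply: card_dyadic_grid_ge2; rewrite ?expn_gt0; case: (Q) Q4 => [|[]].
split=> // B C BC _; apply: lt_le_trans (dyadic_grid_lower Q4 BC); rewrite -qE.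
set n : R := (#|` _|)%:R.
have n1 : 1 <= n by rewrite ler1n ltnW.
have nq : n <= q ^+ 3.
  by rewrite qE -natrX ler_nat; apply: leq_trans (card_dyadic_grid_le _ _ _) _; rewrite -expnSr.
(* As [n >= 1], the exponent [1 - delta < 1/4] may be raised to 1/4, whatever its sign. *)
have n_pow : n `^ (1 - delta) <= y ^+ 6.
  have -> : y ^+ 6 = (q ^+ 3) `^ 4^-1.
    have -> : q ^+ 3 = (y ^+ 6) ^+ 4 by rewrite -y8 -!exprM.
    by rewrite -[_ ^+ 4]powR_mulrn ?exprn_ge0 ?(ltW y0) // -powRrM mulfV ?powRr1 ?exprn_ge0 ?(ltW y0) ?pnatr_eq0.
  apply: (@le_trans _ _ (n `^ 4^-1)); first by rewrite ler_powR //; lra.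
  by rewrite ge0_ler_powR ?nnegrE ?invr_ge0 ?exprn_ge0 // ltW // (lt_le_trans _ n1).
have ln_pow : ln n `^ c <= (24 * c) `^ c * y.
  (* Chosen with [z ^ c = y], so that [ln n <= 3 ln q = 24 c ln z <= 24 c z]. *)
  pose z := q `^ (8 * c)^-1.
  have z0 : 0 < z by rewrite powR_gt0.
  have -> : y = z `^ c by rewrite yE -powRrM; congr (_ `^ _); field; rewrite gt_eqF.
  have c24 : 0 <= 24 * c by rewrite mulr_ge0 // ltW.
  rewrite -powRM ?(ltW z0) //.
  apply: ge0_ler_powR; rewrite ?nnegrE ?ln_ge0 ?mulr_ge0 ?(ltW z0) ?(ltW c0) //.
  apply: (@le_trans _ _ (ln (q ^+ 3))); first by rewrite ler_ln ?posrE ?exprn_gt0 // (lt_le_trans _ n1).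
  have := ln_sublinear z0; rewrite ln_powR lnXn // => /ltW.
  rewrite ler_pdivrMl ?mulr_gt0 // => h; rewrite -mulr_natl.
  lra.
rewrite ltr_pdivlMr //.
apply: (@le_lt_trans _ _ (K * y ^+ 6 * ((24 * c) `^ c * y) * 1024)).
  by rewrite ler_wpM2r // ler_pM ?mulr_ge0 ?powR_ge0 ?(ltW K0) // ler_wpM2l // ltW.
have -> : K * y ^+ 6 * ((24 * c) `^ c * y) * 1024 = M * y ^+ 7 by rewrite /M; ring.
by rewrite -y8 (exprS y 7) ltr_pM2r ?exprn_gt0.
Qed.

Theorem theorem4 (R : realType) :
  (exists K c : R, [/\ 0 < K, 0 < c &
     forall A : {fset R}, (2 <= #|` A|)%N ->
     exists B C : {fset R},
       [/\ B `|` C = A, [disjoint B & C] &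
           Num.max (Dplus B) (Dtimes C)
             <= K * #|` A|%:R `^ (1 - 2 / 5) * ln #|` A|%:R `^ c]])
  /\
  (forall delta K c : R, 3 / 4 < delta -> 0 < K -> 0 < c ->
     exists A : {fset R}, (2 <= #|` A|)%N /\
     forall B C : {fset R}, B `|` C = A -> [disjoint B & C] ->
       K * #|` A|%:R `^ (1 - delta) * ln #|` A|%:R `^ c
         < Num.max (Dplus B) (Dtimes C)).
Proof.
split; first exact: decomposition_bound.
move=> delta K c; exact: decomposition_lower.
Qed.
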